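(* Let $(I,\rho)$ be a standard Bernoulli graph and $d\in\mathbb N$. For any $(\pi,\psi)\in\mathcal{E}xt^d(I,\rho)$ there exists an irreducible $(\pi,\psi)$-extension $(\pi_*,\psi_* )\in\mathcal{E}xt^d(I,\rho)$, unique up to equivalence, such that $(\pi_*,\psi_* )\preceq(\pi,\psi)$.
   Context: **Stochastic graphs.** A stochastic graph $(G,p)$ is a directed graph with countable (finite or infinite) edge set $G$, vertex set $G^{(0)}$, start and terminal maps $s,t:G\to G^{(0)}$, such that $G_u=\{g:s(g)=u\}$ and ${}_vG=\{g:t(g)=v\}$ are nonempty for all vertices, with weights $p(g)>0$ satisfying $\sum_{g\in G_u}p(g)=1$ for every $u$. Standing assumption (positive recurrence): there are stationary probabilities $p^{(0)}(u)>0$ with $\sum_u p^{(0)}(u)=1$ and $\sum_{g\in {}_vG}p(g)p^{(0)}(s(g))=p^{(0)}(v)$ for all $v$. $G$ is irreducible if for all vertices $u,v$ there are $g_1,\dots,g_n\in G$ with $s(g_k)=t(g_{k+1})$, $s(g_n)=u$, $t(g_1)=v$. Let $X_G=\{(x_n)_{n\ge1}\in G^{\mathbb N}: s(x_n)=t(x_{n+1})\ \forall n\}$, with $m_G(x_1=g_1,\dots,x_n=g_n)=p(g_1)\cdots p(g_n)p^{(0)}(s(g_n))$ on cylinders. **Homomorphisms.** A homomorphism $\phi:G\to H$ is a map of edges for which there is $\phi^{(0)}:G^{(0)}\to H^{(0)}$ with $s(\phi(g))=\phi^{(0)}(s(g))$, $t(\phi(g))=\phi^{(0)}(t(g))$,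 $\phi^{(0)}$ surjective, $\phi|_{G_u}:G_u\to H_{\phi^{(0)}(u)}$ bijective for every $u$, and $p(\phi(g))=p(g)$. An isomorphism is a homomorphism bijective on edges and vertices. For $G$ irreducible, $\phi$ has degree $d$ if for a.e. $x\in X_H$ the fibre over $x$ of $\Phi_\phi:X_G\to X_H$, $(x_n)\mapsto(\phi(x_n))$, consists of $d$ points (mod null sets: the conditional measures of $m_G$ on fibres are uniform on $d$ points). **Bernoulli graph.** $I$ finite or countable, $\rho(i)>0$, $\sum_{i\in I}\rho(i)=1$; $(I,\rho)$ is the stochastic graph with edge set $I$, weights $\rho(i)$ and a single vertex. **Graph skew products.** $Y_d=\{1,\dots,d\}$, $\mathcal A_d$ the group of all permutations of $Y_d$. Given $a:H\to\mathcal A_d$, $\bar H_a$ has edges $H\times Y_d$, vertices $H^{(0)}\times Y_d$, $s(h,y)=(s(h),y)$, $t(h,y)=(t(h),a(h)y)$, $p(h,y)=p(h)$, $p^{(0)}(u,y)=p^{(0)}(u)/d$; its natural projection to $H$ is $(h,y)\mapsto h$. Functions $a_1,a_2:H\to\mathcal A_d$ are cohomologous with respect to $H$ if there is $w:H^{(0)}\to\mathcal A_d$ with $a_2(h)w(s(h))=w(t(h))a_1(h)$ for all $h\in H$. **Extensions.** $\mathcal{E}xt^d(I,\rho)$ is the set of all $(\pi,\psi)$-extensions $\bar H\xrightarrow{\pi}H\xrightarrow{\psi}I$ where $\psi$ is a homomorphism of degree 1, $\bar H=\bar H_a$ is a graph skew product over $H$ generated by some $a:H\to\mathcal A_d$ with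 natural projection $\pi$, and $\bar H$ is irreducible. For $(\pi,\psi)$ and $(\pi_1,\psi_1):\bar H_1\to H_1\to I$ in $\mathcal{E}xt^d(I,\rho)$, with generating functions $a,a_1$, write $(\pi_1,\psi_1)\preceq(\pi,\psi)$ if there are homomorphisms $\bar\kappa:\bar H\to\bar H_1$ and $\kappa:H\to H_1$ with $\pi_1\bar\kappa=\kappa\pi$, $\psi_1\kappa=\psi$, and $a_1\circ\kappa$ cohomologous to $a$ with respect to $H$. Write $(\pi_1,\psi_1)\sim(\pi,\psi)$ (equivalent) if in addition $\kappa,\bar\kappa$ can be chosen to be isomorphisms. $(\pi,\psi)\in\mathcal{E}xt^d(I,\rho)$ is irreducible if $(\pi_1,\psi_1)\in\mathcal{E}xt^d(I,\rho)$ and $(\pi_1,\psi_1)\preceq(\pi,\psi)$ imply $(\pi_1,\psi_1)\sim(\pi,\psi)$. *)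

(* Defs.v *)
From HB Require Import structures.
From mathcomp Require Import all_boot all_order all_algebra all_fingroup.
From mathcomp Require Import all_classical all_reals all_analysis.

Set Implicit Arguments.
Unset Strict Implicit.
Unset Printing Implicit Defensive.
Import Order.TTheory GRing.Theory Num.Theory.
Local Open Scope classical_set_scope.
Local Open Scope ring_scope.

(* A directed graph with edge weights p (wt) and vertex weights p^(0) (st). *)
Record wgraph (R : realType) := WGraph {
  vertex : countType;
  edge : countType;
  src : edge -> vertex;
  tgt : edge -> vertex;
  wt : edge -> R;
  st : vertex -> R }.

Record stochastic (R : realType) (G : wgraph R) : Prop := Stochastic {
  out_nonempty : forall u : vertex G, exists g : edge G, src g = u;
  in_nonempty : forall v : vertex G, exists g : edge G, tgt g = v;
  wt_gt0 : forall g : edge G, 0 < wt g;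
  wt_sum1 : forall u : vertex G,
    (\esum_(g in [set g : edge G | src g = u]) (wt g)%:E = 1)%E;
  st_gt0 : forall u : vertex G, 0 < st u;
  st_sum1 : (\esum_(u in [set: vertex G]) (st u)%:E = 1)%E;
  st_inv : forall v : vertex G,
    (\esum_(g in [set g : edge G | tgt g = v]) (wt g * st (src g))%:E
       = (st v)%:E)%E }.

(* Positive recurrence is part of stochastic, with p^(0) = st as data. *)
Record sgraph (R : realType) := SGraph {
  sgraph_graph :> wgraph R;
  sgraph_stochastic : stochastic sgraph_graph }.

(* The walk g_1 = g, g_2, ..., g_n is read backwards, as s(g_k) = t(g_{k+1}). *)
Definition composable (R : realType) (G : wgraph R) : rel (edge G) :=
  fun g g' => src g == tgt g'.

Definition irreducible_graph (R : realType) (G : wgraph R) : Prop :=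
  forall u v : vertex G, exists (g : edge G) (l : seq (edge G)),
    [/\ path (@composable R G) g l, src (last g l) = u & tgt g = v].

Definition hom_along (R : realType) (G H : wgraph R)
    (f : edge G -> edge H) (f0 : vertex G -> vertex H) : Prop :=
  [/\ forall g, src (f g) = f0 (src g),
      forall g, tgt (f g) = f0 (tgt g),
      forall v, exists u, f0 u = v,
      forall u, set_bij [set g | src g = u] [set h | src h = f0 u] f
    & forall g, wt (f g) = wt g].

Record hom (R : realType) (G H : wgraph R) := Hom {
  hom_fun :> edge G -> edge H;
  hom_ax : exists f0 : vertex G -> vertex H, hom_along hom_fun f0 }.

Definition is_iso (R : realType) (G H : wgraph R) (f : hom G H) : Prop :=
  bijective f /\
  exists f0 : vertex G -> vertex H, hom_along f f0 /\ bijective f0.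

Section PathSpace.
Variables (R : realType) (G : sgraph R).

Definition pathspace : Type :=
  {x : nat -> edge G | forall n, src (x n) = tgt (x n.+1)}.

Lemma sgraph_vertex_ex : exists u : vertex G, True.
Proof.
apply: contrapT => nG; have := st_sum1 (sgraph_stochastic G).
suff -> : [set: vertex G] = set0.
  by rewrite esum_set0 => -[] /eqP; rewrite eq_sym oner_eq0.
by apply/seteqP; split=> // u _; apply: nG; exists u.
Qed.

Lemma pathspace_ex : exists x : pathspace, True.
Proof.
have [u _] := sgraph_vertex_ex.
have [c cP] := choice (in_nonempty (sgraph_stochastic G)).
pose x n := iter n (fun g => c (src g)) (c u).
have xP n : src (x n) = tgt (x n.+1) by rewrite /x iterS cP.
by exists (exist _ x xP).
Qed.

HB.instance Definition _ := gen_eqMixin pathspace.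
HB.instance Definition _ := gen_choiceMixin pathspace.
HB.instance Definition _ := isPointed.Build pathspace (projT1 (cid pathspace_ex)).

Definition cylinder (w : seq (edge G)) : set pathspace :=
  [set x | mkseq (sval x) (size w) = w].

Definition pathm := g_sigma_algebraType (range cylinder).

End PathSpace.

HB.instance Definition _ (R : realType) (G : sgraph R) :=
  Measurable.on (pathm G).

(* The law m_G, characterized by its values on cylinders; such a probability
   exists by Kolmogorov's extension theorem, and it is unique, see
   path_law_unique. *)
Definition path_law (R : realType) (G : sgraph R)
    (m : probability (pathm G) R) : Prop :=
  forall (g : edge G) (l : seq (edge G)), path (@composable R G) g l ->
    m (cylinder (g :: l)) = ((\prod_(h <- g :: l) wt h) * st (src (last g l)))%:E.

Lemma cylinder_nil (R : realType) (G : sgraph R) :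
  cylinder [::] = setT :> set (pathspace G).
Proof. by apply/seteqP; split. Qed.

Lemma cylinder_notpath (R : realType) (G : sgraph R) (g : edge G) l :
  ~~ path (@composable R G) g l -> cylinder (g :: l) = set0.
Proof.
move=> Ngl; apply/seteqP; split=> // x /= xw; apply: (negP Ngl).
have nthx i : (i < (size l).+1)%N -> nth g (g :: l) i = sval x i.
  by move=> il; rewrite -xw nth_mkseq.
apply/(pathP g) => i il; rewrite /composable nthx 1?ltnW//.
by have := nthx i.+1 il; rewrite /= => ->; rewrite (svalP x).
Qed.

Lemma cylinderI (R : realType) (G : sgraph R) (w w' : seq (edge G)) :
  (size w <= size w')%N ->
  cylinder w `&` cylinder w' = cylinder w' \/
  cylinder w `&` cylinder w' = set0.
Proof.
move=> ww'; have takex (x : pathspace G) : cylinder w' x ->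
    mkseq (sval x) (size w) = take (size w) w'.
  by move=> /= <-; rewrite /mkseq -map_take take_iota (minn_idPl _)// size_map size_iota.
have [e|ne] := pselect (take (size w) w' = w).
  left; apply/seteqP; split=> [x []//|x xw']; split=> //.
  by rewrite /cylinder /= (takex x).
by right; apply/seteqP; split=> // x [/= xw /takex]; rewrite xw => /esym.
Qed.

Lemma path_law_unique (R : realType) (G : sgraph R)
    (m m' : probability (pathm G) R) :
  path_law m -> path_law m' ->
  forall A : set (pathm G), measurable A -> m A = m' A.
Proof.
move=> mP m'P; pose C := range (@cylinder R G) `|` [set set0].
move=> A0 mA0; apply: (@measure_unique _ R (pathm G) C (fun=> setT) _ _ _ _ m m' _ _ A0 mA0) => //.
- apply/seteqP; split; apply: smallest_sub.
  + exact: smallest_sigma_algebra.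
  + by move=> A cA; apply: sub_sigma_algebra; left.
  + exact: smallest_sigma_algebra.
  + move=> A [cA|->]; first exact: sub_sigma_algebra.
    exact: sigma_algebra0.
- move=> A B [[w _ <-]|->]; last by rewrite set0I; right.
  move=> [[w' _ <-]|->]; last by rewrite setI0; right.
  have [ww'|/ltnW w'w] := leqP (size w) (size w').
    by have [->|->] := cylinderI ww'; [left; exists w'|right].
  by rewrite setIC; have [->|->] := cylinderI w'w; [left; exists w|right].
- by move=> _; left; exists [::] => //; exact: cylinder_nil.
- by rewrite bigcup_const.
- move=> A [[[|g l] _ <-]|->]; last by rewrite !measure0.
    rewrite cylinder_nil.
    exact: etrans (probability_setT m) (esym (probability_setT m')).
  have [gl|/cylinder_notpath ->] := boolP (path (@composable R G) g l).
    exact: etrans (mP g l gl) (esym (m'P g l gl)).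
  exact: etrans (measure0 m) (esym (measure0 m')).
- move=> _; apply: (@le_lt_trans _ _ 1%E); last by rewrite ltry.
  exact: sprobability_setT.
Qed.

Section Degree.
Variables (R : realType) (G H : sgraph R).

Lemma path_map_subproof (f : hom G H) (x : pathspace G) n :
  src (f (sval x n)) = tgt (f (sval x n.+1)).
Proof.
by have [f0 [fs ft _ _ _]] := hom_ax f; rewrite fs ft (svalP x).
Qed.

Definition path_map (f : hom G H) (x : pathspace G) : pathspace H :=
  exist _ (fun n => f (sval x n)) (path_map_subproof f x).

(* k is the disintegration of m_G over m_H along path_map f. *)
Definition has_degree (f : hom G H) (d : nat) : Prop :=
  exists (mG : probability (pathm G) R) (mH : probability (pathm H) R)
         (k : R.-pker (pathm H) ~> (pathm G)),
  [/\ path_law mG,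
      path_law mH,
      forall (A : set (pathm G)) (B : set (pathm H)),
        measurable A -> measurable B ->
        (mG (A `&` path_map f @^-1` B) = \int[mH]_(x in B) k x A)%E
    & {ae mH, forall x, exists y : 'I_d -> pathm G,
        [/\ injective y,
            forall i, path_map f (y i) = x
          & forall A : set (pathm G), measurable A ->
              (k x A = (d%:R^-1)%:E * \sum_(i < d) \d_(y i) A)%E]}].

End Degree.

Section Bernoulli.
Variables (R : realType) (I : countType) (rho : I -> R).

Definition bernoulli_wgraph : wgraph R :=
  @WGraph R unit I (fun=> tt) (fun=> tt) rho (fun=> 1).

Lemma bernoulli_stochastic :
  (forall i, 0 < rho i) -> (\esum_(i in [set: I]) (rho i)%:E = 1)%E ->
  stochastic bernoulli_wgraph.
Proof.
move=> rho0 rho1.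
have exI : exists i : I, True.
  apply: contrapT => nI; move: rho1; suff -> : [set: I] = set0.
    by rewrite esum_set0 => -[] /eqP; rewrite eq_sym oner_eq0.
  by apply/seteqP; split=> // u _; apply: nI; exists u.
have eT (f : I -> unit) u : [set i | f i = u] = setT.
  by apply/seteqP; split=> // i _ /=; case: (f i); case: u.
split => //=.
- by move=> []; have [i _] := exI; exists i.
- by move=> []; have [i _] := exI; exists i.
- by move=> u; rewrite eT.
- have -> : [set: unit] = [set tt] by apply/seteqP; split=> -[].
  by rewrite esum_set1// lee_fin.
- by move=> v; rewrite eT -rho1; apply: eq_esum => i _; rewrite mulr1.
Qed.

Definition bernoulli (rho0 : forall i, 0 < rho i)
    (rho1 : (\esum_(i in [set: I]) (rho i)%:E = 1)%E) : sgraph R :=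
  SGraph (bernoulli_stochastic rho0 rho1).

End Bernoulli.

Section Skew.
Variables (R : realType) (H : wgraph R) (d : nat).

Definition skew (a : edge H -> 'S_d) : wgraph R :=
  @WGraph R (vertex H * 'I_d)%type (edge H * 'I_d)%type
    (fun x => (src x.1, x.2))
    (fun x => (tgt x.1, a x.1 x.2))
    (fun x => wt x.1)
    (fun u => st u.1 / d%:R).

Definition skew_proj (a : edge H -> 'S_d) : edge (skew a) -> edge H := fst.

(* w(s h) acts first: the product of 'S_d composes in the other order. *)
Definition cohomologous (a1 a2 : edge H -> 'S_d) : Prop :=
  exists w : vertex H -> 'S_d, forall (h : edge H) (y : 'I_d),
    a2 h (w (src h) y) = w (tgt h) (a1 h y).

End Skew.

Lemma esum_pZl (R : realType) (T : choiceType) (A : set T) (r : R)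
    (f : T -> \bar R) : 0 < r -> (forall i, (0 <= f i)%E) ->
  (\esum_(i in A) (r%:E * f i) = r%:E * \esum_(i in A) f i)%E.
Proof.
move=> r0 f0; rewrite /esum -ereal_sup_pZl//; congr ereal_sup.
rewrite image_comp; apply: eq_imagel => X _.
by rewrite /= ge0_mule_fsumr.
Qed.

Lemma skew_stochastic (R : realType) (H : wgraph R) (d : nat)
    (a : edge H -> 'S_d) :
  (0 < d)%N -> stochastic H -> stochastic (skew a).
Proof.
move=> d_gt0 [outH inH wt0 wt1 st0 st1 stI].
have dR : 0 < d%:R :> R by rewrite ltr0n.
split => /=.
- by move=> [u y]; have [g <-] := outH u; exists (g, y).
- move=> [v y]; have [g <-] := inH v.
  by exists (g, (a g)^-1%g y); rewrite /= permKV.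
- by move=> [g y] /=; exact: wt0.
- move=> [u y]; rewrite -(wt1 u).
  rewrite (reindex_esum [set g | src g = u] _ (fun g => (g, y)))//; split.
  + by move=> g /= ->.
  + by move=> g g' _ _ [].
  + by move=> [g z] /= [gu ->]; exists g.
- by move=> [u y] /=; rewrite divr_gt0.
- have -> : [set: vertex H * 'I_d] = [set: vertex H] `*`` (fun=> [set: 'I_d]).
    by apply/seteqP; split.
  rewrite -(esum_esum (a := fun u _ => (st u / d%:R)%:E)); last first.
    by move=> u y _ _; rewrite lee_fin divr_ge0// ltW.
  rewrite -st1; apply: eq_esum => u _.
  have -> : [set: 'I_d] = [set` enum 'I_d].
    by apply/seteqP; split=> y //= _; rewrite mem_enum.
  rewrite esum_fset//; last by move=> i _; rewrite lee_fin divr_ge0// ltW.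
  rewrite -fsbig_seq ?enum_uniq// big_enum /= sumEFin sumr_const card_ord.
  by rewrite -(mulr_natr (st u / d%:R)) divfK// gt_eqF.
- move=> [v y].
  rewrite (reindex_esum [set g | tgt g = v] _ (fun g => (g, (a g)^-1%g y))) /=.
    rewrite [RHS](_ : _ = (d%:R^-1)%:E * (st v)%:E)%E; last first.
      by rewrite -EFinM mulrC.
    rewrite -stI -esum_pZl ?invr_gt0//; last first.
      by move=> g; rewrite lee_fin mulr_ge0// ltW.
    by apply: eq_esum => g _; rewrite -EFinM mulrA mulrC.
  split.
  + by move=> g /= ->; rewrite permKV.
  + by move=> g g' _ _ [].
  + by move=> [g z] /= [gv zy]; exists g => //; rewrite -zy permK.
Qed.

Lemma skew_proj_hom (R : realType) (H : wgraph R) (d : nat)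
    (a : edge H -> 'S_d) :
  (0 < d)%N -> hom_along (@skew_proj R H d a) fst.
Proof.
move=> d0; split=> //.
- by move=> v; exists (v, Ordinal d0).
- move=> [u y]; split.
  + by move=> [h z] /= [].
  + by move=> [h z] [h' z'] /[!inE] /= -[_ ->] [_ ->]; rewrite /skew_proj /= => ->.
  + by move=> h /= hu; exists (h, y) => //=; rewrite hu.
Qed.

(* The elements of Ext^d(B); only B = bernoulli _ _ is used. *)
Record extension (R : realType) (B : sgraph R) (d : nat) := Extension {
  ext_base : sgraph R;
  ext_fun : edge ext_base -> 'S_d;
  ext_psi : hom ext_base B;
  ext_degree1 : has_degree ext_psi 1;
  ext_irred : irreducible_graph (skew ext_fun) }.

Section Extensions.
Variables (R : realType) (B : sgraph R) (d : nat).
Implicit Types e : extension B d.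

Definition ext_top e : wgraph R := skew (@ext_fun R B d e).

Definition ext_pi e : edge (ext_top e) -> edge (ext_base e) :=
  @skew_proj R (ext_base e) d (@ext_fun R B d e).

Definition ext_morphism e e1 (kbar : hom (ext_top e) (ext_top e1))
    (k : hom (ext_base e) (ext_base e1)) : Prop :=
  [/\ forall x, ext_pi (kbar x) = k (ext_pi x),
      forall h, ext_psi e1 (k h) = ext_psi e h
    & cohomologous (fun h => ext_fun (k h)) (@ext_fun R B d e)].

Definition ext_le e1 e : Prop :=
  exists kbar k, @ext_morphism e e1 kbar k.

Definition ext_equiv e1 e : Prop :=
  exists kbar k, [/\ @ext_morphism e e1 kbar k, is_iso kbar & is_iso k].

Definition ext_irreducible e : Prop :=
  forall e1, ext_le e1 e -> ext_equiv e1 e.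

End Extensions.

(* Main.v *)
(** A homomorphism onto a Bernoulli graph makes H a deterministic automaton: a
    state u and a word of labels determine a walk starting at u. If psi has
    degree 1, the past of the label process determines the current state, and
    approximating the event "the current state is v" by cylinders shows that any
    two states u, u' are synchronized by some word w, that is, both lead under w
    to the same state. Going from u along w and back to u' multiplies the values
    of a to a holonomy in S_d between the fibres over u and u'. A quotient H1 of H
    with a cohomologous to a function lifted from H1 identifies u with u' only if
    this holonomy does not depend on w. Conversely "the holonomy between u and u'
    does not depend on the synchronizing word" is an equivalence relation that is
    invariant under the automaton; its quotient, with the holonomies to
    representatives as transfer function, is the smallest extension below the
    given one, so it is irreducible and every irreducible one is equivalent to it. *)
Require Import Defs.
From HB Require Import structures.
From mathcomp Require Import all_boot all_order all_algebra all_fingroup.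
From mathcomp Require Import all_classical all_reals all_analysis.
From mathcomp Require Import lra.

Set Implicit Arguments.
Unset Strict Implicit.
Unset Printing Implicit Defensive.
Import Order.TTheory GRing.Theory Num.Theory measurable_realfun.
Local Open Scope classical_set_scope.
Local Open Scope ring_scope.
Local Notation hom := Defs.hom.
Local Notation path_map := Defs.path_map.

(** * Words, synchronization and holonomy *)

(** Equivalently, [g] is determined by the pair [(src g, f g)], all pairs occur, and [lift] is the
    inverse map: each state has exactly one outgoing edge per letter. *)
Record deterministic (R : realType) (G : wgraph R) (I : Type)
    (f : edge G -> I) (lift : vertex G -> I -> edge G) : Prop := Deterministic {
  src_lift : forall u i, src (lift u i) = u;
  lab_lift : forall u i, f (lift u i) = i;
  liftK : forall g, lift (src g) (f g) = g }.

Section Words.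
Variables (R : realType) (G : wgraph R) (I : Type).
Variables (f : edge G -> I) (lift : vertex G -> I -> edge G).
Hypothesis fl : deterministic f lift.

(* Words list the most recent letter first, as composable does for walks:
   run reads w from its end. *)
Definition run (u : vertex G) (w : seq I) : vertex G :=
  foldr (fun i v => tgt (lift v i)) u w.

Fixpoint liftw (u : vertex G) (w : seq I) : seq (edge G) :=
  if w is i :: w' then lift (run u w') i :: liftw u w' else [::].

Lemma run_cat u w1 w2 : run u (w1 ++ w2) = run (run u w2) w1.
Proof. by rewrite /run foldr_cat. Qed.

Lemma map_liftw u w : map f (liftw u w) = w.
Proof. by elim: w => //= i w ->; rewrite (lab_lift fl). Qed.

Lemma size_liftw u w : size (liftw u w) = size w.
Proof. by rewrite -[in RHS](map_liftw u w) size_map. Qed.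

Lemma liftw_path u i w :
  path (@composable R G) (lift (run u w) i) (liftw u w).
Proof.
elim: w i => //= j w IH i.
by rewrite /composable (src_lift fl) eqxx IH.
Qed.

Lemma src_last_liftw u i w : src (last (lift (run u w) i) (liftw u w)) = u.
Proof. by elim: w i => /= [i|j w IH i]; [rewrite (src_lift fl) | rewrite IH]. Qed.

Lemma run_path g l : path (@composable R G) g l ->
  run (src (last g l)) (map f l) = src g.
Proof.
elim: l g => //= h l IH g /andP[/eqP gh /IH->].
by rewrite (liftK fl) gh.
Qed.

Lemma liftw_map g l : path (@composable R G) g l ->
  liftw (src (last g l)) (map f (g :: l)) = g :: l.
Proof.
move=> gl /=; rewrite run_path// (liftK fl); congr cons.
elim: l g gl => //= h l IH g /andP[_ hl].
by rewrite run_path// (liftK fl) IH.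
Qed.

Section Cocycle.
Variables (d : nat) (a : edge G -> 'S_d).

Fixpoint transport (u : vertex G) (w : seq I) : 'S_d :=
  if w is i :: w' then (transport u w' * a (lift (run u w') i))%g else 1%g.

Lemma transport_cat u w1 w2 :
  transport u (w1 ++ w2) = (transport u w2 * transport (run u w2) w1)%g.
Proof. by elim: w1 => /= [|i w1 ->]; rewrite ?mulg1// run_cat mulgA. Qed.

Definition sync (u v : vertex G) (w : seq I) : Prop := run u w = run v w.

(* From the fibre over u forward along w, then back to the fibre over v; products
   in 'S_d act on the left factor first. Only meaningful when sync u v w. *)
Definition hol (u v : vertex G) (w : seq I) : 'S_d :=
  (transport u w * (transport v w)^-1)%g.

Definition fiber_equiv (u v : vertex G) : Prop :=
  forall w1 w2, sync u v w1 -> sync u v w2 -> hol u v w1 = hol u v w2.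

Lemma sync_cat u v w w' : sync u v w -> sync u v (w' ++ w).
Proof. by rewrite /sync !run_cat => ->. Qed.

(** Past the synchronizing word both walks use the same edges, so the extra transport cancels
    against its inverse. *)
Lemma hol_cat u v w w' : sync u v w -> hol u v (w' ++ w) = hol u v w.
Proof.
by move=> uv; rewrite /hol !transport_cat uv invMg mulgA mulgK.
Qed.

Lemma hol_trans u v z w : (hol u v w * hol v z w)%g = hol u z w.
Proof. by rewrite /hol mulgA mulgKV. Qed.

Lemma holV u v w : ((hol u v w)^-1)%g = hol v u w.
Proof. by rewrite /hol invMg invgK. Qed.

Lemma fiber_equiv_refl u : fiber_equiv u u.
Proof. by move=> w1 w2 _ _; rewrite /hol !mulgV. Qed.

Lemma fiber_equiv_sym u v : fiber_equiv u v -> fiber_equiv v u.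
Proof.
by move=> uv w1 w2 h1 h2; rewrite -[LHS]holV -[RHS]holV (uv w1 w2).
Qed.

Hypothesis exsync : forall u v, exists w, sync u v w.

(** After [w] only two states are left, as [u] and [z] have merged; synchronizing these two merges
    all three. *)
Lemma exsync3 u v z w : sync u z w ->
  exists w', sync u v (w' ++ w) /\ sync v z (w' ++ w).
Proof.
move=> uz; have [w' uv] := exsync (run u w) (run v w); exists w'.
by rewrite /sync !run_cat -uz.
Qed.

(** A word synchronizing [u] and [z] may leave [v] apart; extending it brings in [v] without
    changing the holonomy, which then splits as a product through [v]. *)
Lemma fiber_equiv_trans u v z :
  fiber_equiv u v -> fiber_equiv v z -> fiber_equiv u z.
Proof.
move=> uv vz w1 w2 uz1 uz2.
have [w1' [uv1 vz1]] := exsync3 v uz1.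
have [w2' [uv2 vz2]] := exsync3 v uz2.
rewrite -(hol_cat w1' uz1) -(hol_cat w2' uz2).
by rewrite -!(hol_trans u v z) (uv _ _ uv1 uv2) (vz _ _ vz1 vz2).
Qed.

Definition sync_word u v : seq I := projT1 (cid (exsync u v)).

Lemma sync_wordP u v : sync u v (sync_word u v).
Proof. by rewrite /sync_word; case: cid. Qed.

(* The canonical value of the holonomy when fiber_equiv u v. *)
Definition chol u v : 'S_d := hol u v (sync_word u v).

Lemma cholE u v w : fiber_equiv u v -> sync u v w -> chol u v = hol u v w.
Proof. by move=> uv; apply: uv; exact: sync_wordP. Qed.

Lemma chol_trans u v z : fiber_equiv u v -> fiber_equiv v z ->
  (chol u v * chol v z)%g = chol u z.
Proof.
move=> uv vz; have [w' [uvw vzw]] := exsync3 v (sync_wordP u z).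
rewrite (cholE uv uvw) (cholE vz vzw) hol_trans.
by rewrite (cholE (fiber_equiv_trans uv vz) (sync_cat w' (sync_wordP u z))).
Qed.

Lemma chol_refl u : chol u u = 1%g.
Proof. by rewrite /chol /hol mulgV. Qed.

Lemma hol_step u v i w :
  hol u v (w ++ [:: i]) =
    (a (lift u i) * hol (tgt (lift u i)) (tgt (lift v i)) w * (a (lift v i))^-1)%g.
Proof.
by rewrite /hol !transport_cat /= !mul1g invMg !mulgA.
Qed.

(** Read after the letter [i], a word synchronizing the successors synchronizes [u] and [v]; the
    factors coming from [i] are the same for all such words and cancel. *)
Lemma fiber_equiv_step u v i : fiber_equiv u v ->
  fiber_equiv (tgt (lift u i)) (tgt (lift v i)).
Proof.
move=> uv w1 w2 s1 s2.
have s w : sync (tgt (lift u i)) (tgt (lift v i)) w -> sync u v (w ++ [:: i]).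
  by rewrite /sync !run_cat.
have := uv _ _ (s _ s1) (s _ s2).
by rewrite !hol_step => /mulIg /mulgI.
Qed.

Lemma chol_step u v i : fiber_equiv u v ->
  chol u v = (a (lift u i) * chol (tgt (lift u i)) (tgt (lift v i)) *
              (a (lift v i))^-1)%g.
Proof.
move=> uv; rewrite (@cholE u v (sync_word (tgt (lift u i)) (tgt (lift v i)) ++ [:: i]))//.
  by rewrite hol_step.
by have := sync_wordP (tgt (lift u i)) (tgt (lift v i)); rewrite /sync !run_cat.
Qed.

(** Once the default satisfies the predicate, [choose] depends on the predicate alone, so equivalent
    vertices get the same representative. *)
Definition rep u : vertex G := choose (fun v => `[<fiber_equiv u v>]) u.

Lemma repP u : fiber_equiv u (rep u).
Proof.
apply/asboolP/(@chooseP _ (fun v => `[<fiber_equiv u v>])).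
exact/asboolP/fiber_equiv_refl.
Qed.

Lemma eq_rep u v : rep u = rep v <-> fiber_equiv u v.
Proof.
split=> [uv|uv].
  have := @repP u; rewrite uv => h; apply: (fiber_equiv_trans h).
  exact/fiber_equiv_sym/repP.
rewrite /rep (@choose_id _ _ u v); first 1 last.
- exact/asboolP/fiber_equiv_refl.
- exact/asboolP.
apply: eq_choose => z; apply/asboolP/asboolP; apply: fiber_equiv_trans => //.
exact: fiber_equiv_sym.
Qed.

Lemma rep_idem u : rep (rep u) = rep u.
Proof. by apply/eq_rep/fiber_equiv_sym/repP. Qed.

End Cocycle.
End Words.

Section HomFromVertexMap.
Variables (R : realType) (G H : wgraph R) (I : Type).
Variables (f : edge G -> I) (lift : vertex G -> I -> edge G).
Variables (f1 : edge H -> I) (lift1 : vertex H -> I -> edge H).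
Hypotheses (fl : deterministic f lift) (fl1 : deterministic f1 lift1).
Variable q0 : vertex G -> vertex H.
Hypothesis q0_surj : forall v, exists u, q0 u = v.
Hypothesis q0_step : forall u i, q0 (tgt (lift u i)) = tgt (lift1 (q0 u) i).
Hypothesis q0_wt : forall u i, wt (lift1 (q0 u) i) = wt (lift u i).

(** Labels parametrize the edges out of [u] as well as those out of [q0 u], and the map preserves
    labels; hence the bijectivity on outgoing edges. *)
Lemma lift_hom : hom_along (fun g => lift1 (q0 (src g)) (f g)) q0.
Proof.
split=> [g|g|//|u|g]; rewrite ?(src_lift fl1)//.
- by rewrite -q0_step (liftK fl).
- split.
  + by move=> g /= <-; rewrite (src_lift fl1).
  + move=> g g' /[!inE] /= gu g'u /(congr1 f1); rewrite !(lab_lift fl1) => gg'.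
    by rewrite -(liftK fl g) -(liftK fl g') gg' gu g'u.
  + move=> h /= hu; exists (lift u (f1 h)); first by rewrite /= (src_lift fl).
    by rewrite (src_lift fl) (lab_lift fl) -hu (liftK fl1).
- by rewrite q0_wt (liftK fl).
Qed.

End HomFromVertexMap.

(** * Quotient graphs *)

Lemma esum_fibers (R : realType) (T T' : choiceType) (f : T -> T') (A : set T)
    (a : T -> \bar R) : (forall x, 0 <= a x)%E ->
  (\esum_(x in A) a x =
   \esum_(y in [set: T']) \esum_(x in A `&` f @^-1` [set y]) a x)%E.
Proof.
move=> a0; rewrite esum_esum//.
apply: (reindex_esum _ _ (fun k : T' * T => k.2)); split.
- by move=> [y x] /= [_ []].
- by move=> [y x] [y' x'] /[!inE] /= -[_ [_ <-]] [_ [_ <-]] ->.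
- by move=> x Ax /=; exists (f x, x).
Qed.

Section Quotient.
Variables (R : realType) (H : sgraph R) (I : countType).
Variables (f : edge H -> I) (lift : vertex H -> I -> edge H).
Hypothesis fl : deterministic f lift.
(** An equivalence relation, encoded by its choice of representatives; [r_step] is its invariance
    under the letters. *)
Variable r : vertex H -> vertex H.
Hypothesis r_idem : forall u, r (r u) = r u.
Hypothesis r_step : forall u i, r (tgt (lift (r u) i)) = r (tgt (lift u i)).
Hypothesis wt_lift : forall u v i, wt (lift u i) = wt (lift v i).

Definition qvertex : countType := {v : vertex H | r v == v}.
(* An edge of the quotient is an edge of H leaving a representative. *)
Definition qedge : countType := {g : edge H | r (src g) == src g}.

Lemma qsrc_subproof (g : qedge) : r (src (val g)) == src (val g).
Proof. exact: (valP g). Qed.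

Lemma qproj0_subproof u : r (r u) == r u.
Proof. by rewrite r_idem. Qed.

Definition qproj0 (u : vertex H) : qvertex := exist _ (r u) (qproj0_subproof u).

(** An edge leaving a representative need not end in one, hence the projection of its target. The
    stationary mass of a class is the total mass of its members; [fine] loses nothing, by
    [qst_fin]. *)
Definition qwgraph : wgraph R :=
  @WGraph R qvertex qedge
    (fun g => exist _ (src (val g)) (qsrc_subproof g))
    (fun g => qproj0 (tgt (val g)))
    (fun g => wt (val g))
    (fun v => fine (\esum_(u in [set u | qproj0 u = v]) (st u)%:E)%E).

Lemma qlift_subproof u i : r (src (lift (r u) i)) == src (lift (r u) i).
Proof. by rewrite (src_lift fl) r_idem. Qed.

Definition qlift (v : qvertex) (i : I) : qedge :=
  exist _ (lift (r (val v)) i) (qlift_subproof (val v) i).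

Definition qlab (g : qedge) : I := f (val g).

Definition qproj (g : edge H) : qedge := qlift (qproj0 (src g)) (f g).

Lemma val_rep (v : qvertex) : r (val v) = val v.
Proof. exact/eqP/(valP v). Qed.

Lemma qproj0_val (v : qvertex) : qproj0 (val v) = v.
Proof. by apply: val_inj; rewrite /= (val_rep v). Qed.

Lemma qdet : deterministic (G := qwgraph) qlab qlift.
Proof.
split=> [u i|u i|g].
- by apply: val_inj; rewrite /= (src_lift fl) val_rep.
- by rewrite /qlab /= (lab_lift fl).
- apply: val_inj => /=; have /eqP -> := valP g.
  exact: (liftK fl).
Qed.

Lemma qlab_proj g : qlab (qproj g) = f g.
Proof. by rewrite /qlab /= (lab_lift fl). Qed.

Lemma qproj_hom : hom_along (H := qwgraph) qproj qproj0.
Proof.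
apply: (lift_hom fl qdet) => [v|u i|u i].
- by exists (val v); exact: qproj0_val.
- by apply: val_inj; rewrite /= r_idem r_step.
- exact: wt_lift.
Qed.

Lemma src_qproj g : src (w := qwgraph) (qproj g) = qproj0 (src g).
Proof. by have [-> _ _ _ _] := qproj_hom. Qed.

Lemma tgt_qproj g : tgt (w := qwgraph) (qproj g) = qproj0 (tgt g).
Proof. by have [_ -> _ _ _] := qproj_hom. Qed.

Lemma wt_qproj g : wt (w := qwgraph) (qproj g) = wt g.
Proof. by have [_ _ _ _ ->] := qproj_hom. Qed.

Let Hst := sgraph_stochastic H.

Lemma st_ge0 (u : vertex H) : (0 <= (st u)%:E)%E.
Proof. by rewrite lee_fin ltW// (st_gt0 Hst). Qed.

Lemma qst_fin (v : qvertex) :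
  (\esum_(u in [set u | qproj0 u = v]) (st u)%:E)%E \is a fin_num.
Proof.
rewrite ge0_fin_numE; last by apply: esum_ge0 => u _; exact: st_ge0.
apply: (@le_lt_trans _ _ 1%E); last by rewrite ltry.
rewrite -(st_sum1 Hst) (esumID [set u | qproj0 u = v] setT); last first.
  by move=> u _; exact: st_ge0.
by rewrite setTI leeDl//; apply: esum_ge0 => u _; exact: st_ge0.
Qed.

Lemma qstE (v : vertex qwgraph) :
  ((st v)%:E = \esum_(u in [set u | qproj0 u = v]) (st u)%:E)%E.
Proof. by rewrite /= fineK// qst_fin. Qed.

Lemma qwgraph_stochastic : stochastic qwgraph.
Proof.
have [_ _ _ pbij _] := qproj_hom.
split.
- move=> v; have [g gv] := out_nonempty Hst (val v).
  by exists (qproj g); rewrite src_qproj gv qproj0_val.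
- move=> v; have [g gv] := in_nonempty Hst (val v).
  by exists (qproj g); rewrite tgt_qproj gv qproj0_val.
- by move=> g; exact: (wt_gt0 Hst).
- move=> v; rewrite -(wt_sum1 Hst (val v)).
  have b := pbij (val v); rewrite qproj0_val in b.
  rewrite (reindex_esum _ _ _ _ b).
  by apply: eq_esum => g _; rewrite wt_qproj.
- move=> v; rewrite -lte_fin qstE; apply: (@lt_le_trans _ _ (st (val v))%:E).
    by rewrite lte_fin (st_gt0 Hst).
  apply: esum_ge; exists [set val v]; last by rewrite fsbig_set1.
  by split; [exact: finite_set1|move=> u /= ->; exact: qproj0_val].
- rewrite -(st_sum1 Hst) [RHS](esum_fibers qproj0)//; last exact: st_ge0.
  by apply: eq_esum => v _; rewrite qstE setTI.
- move=> v.
  have a0 (g : edge H) : (0 <= (wt g * st (src g))%:E)%E.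
    by rewrite lee_fin mulr_ge0// ltW// ?(wt_gt0 Hst)// (st_gt0 Hst).
  (* Stationarity: the flow into the class [v] is summed in two ways, by target in [H], which gives
     the mass of the class, and by image edge in the quotient. *)
  transitivity (\esum_(g in [set g | qproj0 (tgt g) = v])
                   (wt g * st (src g))%:E)%E; last first.
    rewrite (esum_fibers (@tgt _ H))// qstE [RHS]esum_mkcond; apply: eq_esum => u _.
    case: ifPn => [|/negP] uv; rewrite ?inE /= in uv.
      rewrite -(st_inv Hst); congr (\esum_(x in _) _)%E; apply/seteqP; split.
        by move=> g /= [].
      by move=> g /= gu; split=> //; rewrite gu.
    rewrite (_ : _ `&` _ = set0) ?esum_set0//; apply/seteqP; split=> // g /=.
    by move=> [] gv gu; apply: uv; rewrite -gu.
  rewrite [RHS](esum_fibers qproj)// esum_mkcond; apply: eq_esum => h _.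
  case: ifPn => [|/negP] hv; rewrite ?inE /= in hv; last first.
    rewrite (_ : _ `&` _ = set0) ?esum_set0//; apply/seteqP; split=> // g /=.
    by move=> [] gv gh; apply: hv; rewrite -gh -gv; exact: tgt_qproj.
  (* The edges above [h] are the lifts of its label at the members of the class [src h], and all
     have the weight of [h]. *)
  rewrite EFinM qstE -esum_pZl; [|exact: (wt_gt0 Hst)|exact: st_ge0].
  rewrite (@reindex_esum _ _ _ [set u | qproj0 u = src (w := qwgraph) h] _
            (fun u => lift u (qlab h))).
    apply: eq_esum => u /= hu; rewrite (src_lift fl) EFinM.
    by congr (_%:E * _)%E; rewrite -{1}(liftK qdet h) /=; exact: wt_lift.
  split.
  + move=> u /= uh; have e : qproj (lift u (qlab h)) = h.
      rewrite /qproj (src_lift fl) (lab_lift fl) uh; exact: (liftK qdet).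
    split=> //; rewrite -hv.
    exact: etrans (esym (tgt_qproj _)) (congr1 (@tgt _ qwgraph) e).
  + by move=> u u' _ _ /(congr1 (@src _ H)); rewrite !(src_lift fl).
  + move=> g /= [gv gh]; exists (src g); first by rewrite -src_qproj gh.
    by rewrite -gh qlab_proj (liftK fl).
Qed.

Definition qgraph : sgraph R := SGraph qwgraph_stochastic.

End Quotient.

(** * Path spaces *)

Lemma measure_bigcup_esum d (T : measurableType d) (R : realType)
    (mu : {measure set T -> \bar R}) (J : countType) (D : set J)
    (F : J -> set T) :
  (forall j, measurable (F j)) -> trivIset D F ->
  (mu (\bigcup_(j in D) F j) = \esum_(j in D) mu (F j))%E.
Proof.
move=> mF tF; pose F' n := if unpickle n is Some j then F j else set0.
have F'E j : F' (pickle j) = F j by rewrite /F' pickleK.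
transitivity (mu (\bigcup_(n in pickle @` D) F' n)).
  by rewrite bigcup_image; congr (mu _); apply: eq_bigcupr => j _; rewrite F'E.
rewrite measure_bigcup; first 1 last.
- by move=> n _; rewrite /F'; case: unpickle.
- apply/trivIsetP => _ _ [i Di <-] [j Dj <-] ij; rewrite !F'E.
  by move/trivIsetP: tF; apply => //; apply: contraNneq ij => ->.
rewrite nneseries_esum// set_mem_set esum_image; last first.
  by move=> i j _ _; exact: (pcan_inj pickleK).
by apply: eq_esum => j _; rewrite F'E.
Qed.

Lemma measurable_bigcup_count d (T : measurableType d) (J : countType)
    (D : set J) (F : J -> set T) :
  (forall j, measurable (F j)) -> measurable (\bigcup_(j in D) F j).
Proof.
move=> mF; rewrite bigcup_mkcond; apply: countable_bigcupT_measurable => // j.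
by case: ifP.
Qed.

(** * Push-forward of probability kernels *)

Section PushKernel.
Context d1 d2 d3 (X : measurableType d1) (Y : measurableType d2)
  (Z : measurableType d3) (R : realType).
Variables (k : R.-pker X ~> Y) (f : {mfun Y >-> Z}).

Let push (x : X) : set Z -> \bar R := pushforward (k x) f.

Let push0 x : push x set0 = 0%E.
Proof. exact: measure0. Qed.

Let push_ge0 x A : (0 <= push x A)%E.
Proof. exact: measure_ge0. Qed.

Let push_sigma_additive x : semi_sigma_additive (push x).
Proof. exact: measure_semi_sigma_additive. Qed.

HB.instance Definition _ x := isMeasure.Build _ _ _ (push x)
  (push0 x) (push_ge0 x) (@push_sigma_additive x).

Definition kpush (x : X) : {measure set Z -> \bar R} := push x.

Let kpush_measurable U : measurable U ->
  measurable_fun [set: X] (kpush ^~ U).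
Proof.
move=> mU; apply: (measurable_kernel k (f @^-1` U)).
by rewrite -[X in measurable X]setTI; exact: measurable_funPT.
Qed.

HB.instance Definition _ :=
  isKernel.Build _ _ X Z R kpush kpush_measurable.

Let kpush_prob x : kpush x [set: Z] = 1%E.
Proof. by rewrite /kpush /= /push /pushforward preimage_setT prob_kernel. Qed.

HB.instance Definition _ :=
  Kernel_isProbability.Build _ _ X Z R kpush kpush_prob.

End PushKernel.

Section PathMeasure.
Variables (R : realType).
Implicit Types G H K B : sgraph R.

Lemma measurable_cylinder G w : measurable (cylinder w : set (pathm G)).
Proof. by apply: sub_sigma_algebra; exists w. Qed.

Lemma cylinder_trivIset G n (D : set (seq (edge G))) :
  (forall w, D w -> size w = n) -> trivIset D (@cylinder R G).
Proof.
move=> Dn w w' /Dn wn /Dn w'n [x [/= <- <-]].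
by rewrite wn w'n.
Qed.

Lemma map_mkseq_path_map G H (f : hom G H) (x : pathspace G) n :
  mkseq (sval (path_map f x)) n = map f (mkseq (sval x) n).
Proof. by rewrite /mkseq -map_comp. Qed.

Lemma preimage_cylinder G H (f : hom G H) (w : seq (edge H)) :
  path_map f @^-1` cylinder w =
  \bigcup_(w' in [set w' | map f w' = w]) cylinder w'.
Proof.
apply/seteqP; split=> [x xw|x [w' /= <-]]; last first.
  by rewrite /cylinder /= size_map => xw'; rewrite map_mkseq_path_map xw'.
exists (mkseq (sval x) (size w)); last by rewrite /cylinder /= size_mkseq.
by rewrite /= -map_mkseq_path_map; exact: xw.
Qed.

Lemma measurable_path_map G H (f : hom G H) :
  measurable_fun setT (path_map f : pathm G -> pathm H).
Proof.
apply: (@measurability _ _ (pathm G) (pathm H) setT (path_map f)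
  (range (@cylinder R H))) => //.
move=> _ [_ [w _ <-] <-]; rewrite setTI preimage_cylinder.
by apply: measurable_bigcup_count => w'; exact: measurable_cylinder.
Qed.

(* Retyped so that path_map is found as a map of measurable types. *)
Definition pathm_map G H (f : hom G H) : pathm G -> pathm H := path_map f.

HB.instance Definition _ G H (f : hom G H) :=
  isMeasurableFun.Build _ _ (pathm G) (pathm H) (pathm_map f)
    (measurable_path_map f).

Lemma path_map_preimage_measurable G H (f : hom G H) (A : set (pathm H)) :
  measurable A -> measurable (path_map f @^-1` A : set (pathm G)).
Proof.
move=> mA; rewrite -[X in measurable X]setTI.
exact: (measurable_path_map f).
Qed.

Lemma eq_pathspace G (x y : pathspace G) : sval x =1 sval y -> x = y.
Proof.
case: x y => [x xP] [y yP] /= /funext xy; rewrite {}xy in xP *.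
by congr exist; exact: Prop_irrelevance.
Qed.

Lemma path_map_comp G H K (f : hom G H) (g : hom H K) (h : hom G K) :
  (forall e, g (f e) = h e) -> forall x, path_map g (path_map f x) = path_map h x.
Proof. by move=> gf x; apply: eq_pathspace => n /=; rewrite gf. Qed.

(* The law, the disintegration and the fibre points are pushed forward by q. *)
Lemma has_degree1_factor G H B (q : hom G H) (psi : hom G B) (psi1 : hom H B) :
  (forall g, psi1 (q g) = psi g) ->
  (forall m : probability (pathm G) R, path_law m ->
    path_law (distribution m (pathm_map q))) ->
  has_degree psi 1 -> has_degree psi1 1.
Proof.
move=> qpsi qlaw [mG [mB [k [mGP mBP dis aek]]]].
exists (distribution mG (pathm_map q)), mB.
exists (kpush k (pathm_map q)).
split=> //; first exact: qlaw.
  move=> A C mA mC.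
  transitivity (mG (path_map q @^-1` A `&` path_map psi @^-1` C)).
    rewrite /distribution /pushforward /=; congr (mG _).
    by apply/seteqP; split=> x /=; rewrite (path_map_comp qpsi).
  by rewrite dis//; exact: path_map_preimage_measurable.
apply: negligibleS aek => x; apply: contra_not => -[y [_ yx ky]].
exists (path_map q \o y); split.
- by move=> i j _; rewrite (ord1 i) (ord1 j).
- by move=> i /=; rewrite (path_map_comp qpsi) yx.
- move=> A mA; rewrite /kpush /= /pushforward ky//.
  exact: path_map_preimage_measurable.
Qed.

End PathMeasure.

Section Lifting.
Variables (R : realType) (G H : wgraph R) (I : Type).
Variables (f : edge G -> I) (lift : vertex G -> I -> edge G).
Variables (f1 : edge H -> I) (lift1 : vertex H -> I -> edge H).
Hypotheses (fl : deterministic f lift) (fl1 : deterministic f1 lift1).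
Variables (q : edge G -> edge H) (q0 : vertex G -> vertex H).
Hypotheses (qhom : hom_along q q0) (f1q : forall g, f1 (q g) = f g).

(** The image edge has source [q0 u] and label [i], and only one edge has both. *)
Lemma hom_lift u i : q (lift u i) = lift1 (q0 u) i.
Proof.
have [sq _ _ _ _] := qhom.
by rewrite -(liftK fl1 (q _)) sq f1q (src_lift fl) (lab_lift fl).
Qed.

Lemma hom_run u w : q0 (run lift u w) = run lift1 (q0 u) w.
Proof.
have [_ tq _ _ _] := qhom.
by elim: w => //= i w <-; rewrite -tq hom_lift.
Qed.

Lemma hom_liftw u w : map q (liftw lift u w) = liftw lift1 (q0 u) w.
Proof. by elim: w => //= i w ->; rewrite hom_lift hom_run. Qed.

End Lifting.

Section PathPrefix.
Variables (R : realType) (G : sgraph R).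

Lemma mkseqS (T : Type) (x : nat -> T) n :
  mkseq x n.+1 = x 0%N :: mkseq (x \o S) n.
Proof. by rewrite /mkseq /= -[1%N]addn0 iotaDl -map_comp. Qed.

Lemma composable_mkseq (x : pathspace G) n :
  path (@composable R G) (sval x 0%N) (mkseq (sval x \o S) n).
Proof.
apply/(pathP (sval x 0%N)) => i; rewrite size_mkseq => ni.
rewrite nth_mkseq// /composable /= -mkseqS nth_mkseq; last exact: ltnW.
by rewrite (svalP x).
Qed.

End PathPrefix.

Section QuotientLaw.
Variables (R : realType) (H : sgraph R) (I : countType).
Variables (f : edge H -> I) (lift : vertex H -> I -> edge H).
Hypothesis fl : deterministic f lift.
Variable r : vertex H -> vertex H.
Hypothesis r_idem : forall u, r (r u) = r u.
Hypothesis r_step : forall u i, r (tgt (lift (r u) i)) = r (tgt (lift u i)).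
Hypothesis wt_lift : forall u v i, wt (lift u i) = wt (lift v i).

Let Q := qgraph fl r_idem r_step wt_lift.
Let qhom : hom_along (H := Q) (qproj fl r_idem) (qproj0 r_idem).
Proof. exact: qproj_hom. Qed.

Definition qproj_morphism : hom H Q := @Defs.Hom R H Q _ (ex_intro _ _ qhom).

Local Notation qlab' := (@qlab R H I f r).

Let qlabE g : qlab' (qproj_morphism g) = f g.
Proof. exact: qlab_proj. Qed.

(** A walk of [H] above a walk of the quotient is determined by its labels and its initial vertex,
    which ranges over a whole class; [last] is the earliest edge. *)
Lemma preimage_qcylinder g l : path (@composable R Q) g l ->
  path_map qproj_morphism @^-1` cylinder (g :: l) =
  \bigcup_(u in [set u | qproj0 r_idem u = src (last g l)])
    cylinder (liftw lift u (map qlab' (g :: l))).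
Proof.
move=> gl; have qd := qdet fl r_idem.
have := liftw_map qd gl; have -> : last g l = last g (g :: l) by [].
have : size (g :: l) = (size l).+1 by [].
move: (g :: l) => w sw wE; apply/seteqP; split=> x.
  rewrite /cylinder /preimage /= sw => e.
  have e' : map qproj_morphism (mkseq (sval x) (size l).+1) = w.
    by rewrite -[RHS]e /mkseq -map_comp.
  have xp := composable_mkseq x (size l).
  exists (src (last (sval x 0%N) (mkseq (sval x \o S) (size l)))).
    have [sq _ _ _ _] := qhom; rewrite /= -sq.
    by rewrite -e' mkseqS /= last_map.
  rewrite (size_liftw fl) size_map sw -e' -map_comp.
  rewrite (eq_map (g := f)); last exact: qlabE.
  by rewrite mkseqS (liftw_map fl xp) -mkseqS.
move=> [u /= uv]; rewrite /cylinder /preimage /= (size_liftw fl) size_map => e.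
transitivity (map qproj_morphism (mkseq (sval x) (size w))).
  by rewrite /mkseq -map_comp.
by rewrite e (hom_liftw fl qd qhom qlabE) uv.
Qed.

Lemma quotient_path_law (m : probability (pathm H) R) :
  path_law m -> path_law (distribution m (pathm_map qproj_morphism)).
Proof.
move=> mP g l gl.
rewrite -[LHS]/(m (path_map qproj_morphism @^-1` cylinder (g :: l))).
rewrite preimage_qcylinder// measure_bigcup_esum; first 1 last.
- by move=> u; exact: measurable_cylinder.
(* Disjointness: the source of the earliest edge recovers the initial vertex. *)
- move=> u v _ _ [x []]; rewrite /cylinder /= !(size_liftw fl) => ->.
  move=> /(congr1 (map (@src _ H))).
  move/(congr1 (fun s => last (src (sval x 0%N)) s)) => /=.
  by rewrite !last_map !(src_last_liftw fl).
rewrite EFinM qstE -esum_pZl//; first 1 last.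
- by apply: prodr_gt0 => h _; exact: (wt_gt0 (sgraph_stochastic Q)).
- by move=> u; exact: st_ge0.
(* Lifting preserves weights, so the cylinders differ only in the factor [st u]. *)
apply: eq_esum => u uv /=.
rewrite mP; last exact: (liftw_path fl).
rewrite (src_last_liftw fl) EFinM; congr (_%:E * _)%E.
have e := hom_liftw fl (qdet fl r_idem) qhom qlabE u (map qlab' (g :: l)).
rewrite -(liftw_map (qdet fl r_idem) gl) -uv -e.
rewrite big_map; apply: eq_bigr => h _; exact/esym/wt_qproj.
Qed.

End QuotientLaw.

(** * Degree one and synchronization *)

Section BernoulliLift.
Variables (R : realType) (I : countType) (rho : I -> R).
Variables (rho_gt0 : forall i, 0 < rho i)
  (rho_sum1 : (\esum_(i in [set: I]) (rho i)%:E = 1)%E).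
Variables (H : wgraph R) (psi : hom H (bernoulli rho_gt0 rho_sum1)).

(** The Bernoulli graph has one vertex, so the edges leaving any vertex of [H] correspond
    bijectively to the whole alphabet. *)
Lemma bernoulli_lift : exists lift : vertex H -> I -> edge H,
  deterministic (psi : edge H -> I) lift.
Proof.
have [f0 [_ _ _ pbij _]] := hom_ax psi.
have ex (u : vertex H) (i : I) : exists g, src g = u /\ psi g = i.
  have [_ _ /(_ i)] := pbij u.
  by case=> [|g gu <-]; [case: (f0 u)|exists g].
have [lift liftP] := choice (fun ui => ex ui.1 ui.2).
exists (fun u i => lift (u, i)); split=> [u i|u i|g].
- by have [] := liftP (u, i).
- by have [] := liftP (u, i).
- have [/= sg pg] := liftP (src g, psi g).
  have [_ inj _] := pbij (src g).
  by apply: inj => //; rewrite inE.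
Qed.

Lemma wt_bernoulli (g : edge H) : wt g = rho (psi g).
Proof. by have [f0 [_ _ _ _ <-]] := hom_ax psi. Qed.

End BernoulliLift.

(** * Approximation of events by finite prefixes *)

Section Approximation.
Variables (R : realType) (G : sgraph R) (m : probability (pathm G) R).

Definition prefix_set n (D : set (seq (edge G))) : set (pathm G) :=
  [set x : pathspace G | D (mkseq (sval x) n)].

Lemma prefix_setE n D :
  prefix_set n D = \bigcup_(w in [set w | D w /\ size w = n]) cylinder w.
Proof.
apply/seteqP; split=> [x Dx|x [w [Dw wn]]]; last first.
  by rewrite /cylinder /prefix_set /= wn => ->.
exists (mkseq (sval x) n); first by rewrite /= size_mkseq.
by rewrite /cylinder /= size_mkseq.
Qed.

Lemma measurable_prefix_set n D : measurable (prefix_set n D).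
Proof.
rewrite prefix_setE; apply: measurable_bigcup_count => w.
exact: measurable_cylinder.
Qed.

Lemma prefix_set_widen n k D : (n <= k)%N ->
  prefix_set n D = prefix_set k [set w | D (take n w)].
Proof.
move=> nk; apply/seteqP; split=> x; rewrite /prefix_set /=.
  by rewrite /mkseq -map_take take_iota (minn_idPl nk).
by rewrite /mkseq -map_take take_iota (minn_idPl nk).
Qed.

(** The length [n.+1] excludes the empty prefix, so that every word in use has the form [i :: w], to
    which the cylinder bounds apply. *)
Definition approximable (A : set (pathm G)) : Prop :=
  measurable A /\ forall eps : R, 0 < eps ->
    exists n D, (m (A `+` prefix_set n.+1 D) <= eps%:E)%E.

Lemma approximable_cylinder w : approximable (cylinder w).
Proof.
split; first exact: measurable_cylinder.
suff [n [D ->]] : exists n D, cylinder w = prefix_set n.+1 D.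
  by move=> e e0; exists n, D; rewrite setYK measure0 lee_fin ltW.
case: w => [|g l].
  by exists 0%N, setT; rewrite cylinder_nil.
by exists (size l), [set g :: l].
Qed.

Lemma approximableC A : approximable A -> approximable (~` A).
Proof.
move=> [mA Aapp]; split; first exact: measurableC.
move=> e /Aapp[n [D le]]; exists n, (~` D).
have -> : prefix_set n.+1 (~` D) = ~` prefix_set n.+1 D by [].
suff -> : ~` A `+` ~` prefix_set n.+1 D = A `+` prefix_set n.+1 D by [].
by rewrite !setY_def !setDE !setCK setUC (setIC (~` A)) (setIC (~` _) A).
Qed.

Lemma measurableY (A B : set (pathm G)) :
  measurable A -> measurable B -> measurable (A `+` B).
Proof. by move=> mA mB; apply: measurableU; exact: measurableD. Qed.

Lemma setYU_sub (A B A' B' : set (pathm G)) :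
  (A `|` B) `+` (A' `|` B') `<=` (A `+` A') `|` (B `+` B').
Proof.
move=> x; rewrite !setY_def => -[[[Ax|Bx] /not_orP[nA nB]]|[[Ax|Bx] /not_orP[nA nB]]].
- by left; left.
- by right; left.
- by left; right.
- by right; right.
Qed.

Lemma approximableU A B : approximable A -> approximable B ->
  approximable (A `|` B).
Proof.
move=> [mA Aapp] [mB Bapp]; split; first exact: measurableU.
move=> e e0; have e2 : 0 < e / 2 by rewrite divr_gt0.
have [n [D le1]] := Aapp _ e2; have [k [D' le2]] := Bapp _ e2.
pose N := maxn n k.
rewrite (@prefix_set_widen n.+1 N.+1) ?ltnS ?leq_maxl// in le1.
rewrite (@prefix_set_widen k.+1 N.+1) ?ltnS ?leq_maxr// in le2.
move: le1 le2; set E := [set w | _]; set E' := [set w | _] => le1 le2.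
exists N, (E `|` E').
have -> : prefix_set N.+1 (E `|` E') = prefix_set N.+1 E `|` prefix_set N.+1 E' by [].
have mE := measurable_prefix_set N.+1 E.
have mE' := measurable_prefix_set N.+1 E'.
apply: (@le_trans _ _ (m ((A `+` prefix_set N.+1 E) `|` (B `+` prefix_set N.+1 E')))).
  apply: le_measure; rewrite ?inE; last exact: setYU_sub.
    by apply: measurableY; exact: measurableU.
  by apply: measurableU; exact: measurableY.
apply: (le_trans (measureU2 _ _ _)); [exact: measurableY|exact: measurableY|].
by rewrite (splitr e) EFinD leeD.
Qed.

Lemma approximable0 : approximable set0.
Proof.
split=> // e e0; exists 0%N, set0.
have -> : prefix_set 1 set0 = set0 by [].
by rewrite setYK measure0 lee_fin ltW.
Qed.

(** By continuity from above, a finite partial union misses little of the whole; half of [e] pays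
    for this and half for approximating the partial union. *)
Lemma approximable_bigcup (F : (set (pathm G))^nat) :
  (forall n, approximable (F n)) -> approximable (\bigcup_n F n).
Proof.
move=> Fapp; have mF n : measurable (F n) by have [] := Fapp n.
have mU : measurable (\bigcup_n F n) by exact: bigcupT_measurable.
split=> // e e0; have e2 : 0 < e / 2 by rewrite divr_gt0.
pose A n := \big[setU/set0]_(i < n) F i.
have Aapp n : approximable (A n).
  rewrite /A; elim: n => [|n IH]; first by rewrite big_ord0; exact: approximable0.
  by rewrite big_ord_recr /=; exact: approximableU.
have mA n : measurable (A n) by have [] := Aapp n.
pose B n := (\bigcup_n F n) `\` A n.
have mB n : measurable (B n) by exact: measurableD.
have B0 : \bigcap_n B n = set0.
  apply/seteqP; split=> // x Bx; have [[i _ Fix] _] := Bx 0%N I.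
  have [_] := Bx i.+1 I; apply; rewrite /A -bigcup_mkord.
  by exists i => /=.
have : m \o B @ \oo --> m (\bigcap_n B n).
  apply: nonincreasing_cvg_mu => //.
  - by rewrite -ge0_fin_numE//; exact: fin_num_measure.
  - by rewrite B0.
  - move=> i j ij; apply/subsetPset; apply: setDS.
    exact: subset_bigsetU.
rewrite B0 measure0 => /(_ [set y | (y < (e / 2)%:E)%E]) [].
  by apply: open_nbhs_nbhs; split; [exact: open_ereal_lt_ereal|rewrite /= lte_fin].
move=> N _ /(_ N (leqnn N)) /= /ltW leB.
have [_ /(_ _ e2)[n [D leA]]] := Aapp N.
have mD := measurable_prefix_set n.+1 D.
exists n, D.
apply: (@le_trans _ _ (m (B N `|` (A N `+` prefix_set n.+1 D)))).
  apply: le_measure; rewrite ?inE.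
  - exact: measurableY.
  - by apply: measurableU => //; exact: measurableY.
  - move=> x; rewrite !setY_def => -[[Ux nDx]|[Dx nUx]].
      by have [Ax|nAx] := pselect (A N x); [right; left|left].
    right; right; split=> // Ax; apply: nUx.
    by move: Ax; rewrite /A -bigcup_mkord => -[i _ Fix]; exists i.
apply: (le_trans (measureU2 _ _ _)) => //; first exact: measurableY.
by rewrite (splitr e) EFinD leeD.
Qed.

(** The approximable sets form a sigma-algebra containing the cylinders. *)
Lemma measurable_approximable A : measurable A -> approximable A.
Proof.
suff : @measurable _ (pathm G) `<=` approximable by exact.
apply: smallest_sub; last by move=> _ [w _ <-]; exact: approximable_cylinder.
split; first exact: approximable0.
- by move=> B /approximableC; rewrite setTD.
- exact: approximable_bigcup.
Qed.

End Approximation.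

Section Synchronization.
Variables (R : realType) (I : countType) (rho : I -> R).
Variables (rho_gt0 : forall i, 0 < rho i)
  (rho_sum1 : (\esum_(i in [set: I]) (rho i)%:E = 1)%E).
Local Notation B := (bernoulli rho_gt0 rho_sum1).
Variables (H : sgraph R) (psi : hom H B) (lift : vertex H -> I -> edge H).
Hypothesis fl : deterministic (psi : edge H -> I) lift.
Variables (mH : probability (pathm H) R) (mB : probability (pathm B) R)
  (k : R.-pker (pathm B) ~> (pathm H)).
Hypotheses (mHP : path_law mH) (mBP : path_law mB).
Hypothesis dis : forall (A : set (pathm H)) (C : set (pathm B)),
  measurable A -> measurable C ->
  (mH (A `&` path_map psi @^-1` C) = \int[mB]_(x in C) k x A)%E.
Hypothesis fibre : {ae mB, forall x, exists y : 'I_1 -> pathm H,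
  [/\ injective y, forall i, path_map psi (y i) = x
    & forall A : set (pathm H), measurable A ->
        (k x A = (1%:R^-1)%:E * \sum_(i < 1) \d_(y i) A)%E]}.

Let mpre (C : set (pathm B)) : measurable C ->
  measurable (path_map psi @^-1` C : set (pathm H)).
Proof. exact: path_map_preimage_measurable. Qed.

Let pushH (C : set (pathm B)) : measurable C ->
  (mH (path_map psi @^-1` C) = mB C)%E.
Proof.
move=> mC; rewrite -[X in mH X]setTI dis//.
under eq_integral do rewrite prob_kernel.
by rewrite integral_cst// mul1e.
Qed.

Let bcylE (i : I) (w : seq I) :
  mB (cylinder (G := B) (i :: w)) = (\prod_(h <- i :: w) rho h)%:E.
Proof.
rewrite mBP; first by rewrite /= mulr1.
by elim: w i => //= j w IH i.
Qed.

Let cylE u (i : I) (w : seq I) :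
  (mH (cylinder (liftw lift u (i :: w))) =
   (st u)%:E * mB (cylinder (G := B) (i :: w)))%E.
Proof.
rewrite bcylE mHP; last exact: (liftw_path fl).
rewrite (src_last_liftw fl) mulrC EFinM; congr (_ * _%:E)%E.
rewrite -[X in \prod_(h <- X) rho h](map_liftw fl u) big_map.
by apply: eq_bigr => h _; exact: wt_bernoulli.
Qed.

Variable v : vertex H.

Let V : set (pathm H) := [set x : pathspace H | tgt (sval x 0%N) = v].

Let mV : measurable V.
Proof.
have -> : V = prefix_set 1 [set w | exists2 g, w = [:: g] & tgt g = v].
  apply/seteqP; split=> x; rewrite /V /prefix_set /=.
    by exists (sval x 0%N).
  by move=> [g [->]].
exact: measurable_prefix_set.
Qed.

Let V_gt0 : (0 < mH V)%E.
Proof.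
have [g gv] := in_nonempty (sgraph_stochastic H) v.
apply: (@lt_le_trans _ _ (mH (cylinder [:: g]))).
  rewrite mHP//= lte_fin big_seq1 mulr_gt0//.
    exact: (wt_gt0 (sgraph_stochastic H)).
  exact: (st_gt0 (sgraph_stochastic H)).
apply: le_measure; rewrite ?inE//; first exact: measurable_cylinder.
by move=> x; rewrite /cylinder /V /= => -[->].
Qed.

(* Up to a null set, the label sequences whose lift arrives in v. *)
Let S : set (pathm B) := [set x | k x V = 1%E].

Let mS : measurable S.
Proof.
have -> : S = setT `&` (fun x => k x V) @^-1` [set 1%E] by rewrite setTI.
exact: (measurable_kernel k V mV).
Qed.

(** Almost every fibre measure is a point mass, so [k x V] is 0 or 1; were it almost never 1,
    integration would give [mH V = 0]. *)
Let S_gt0 : (0 < mB S)%E.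
Proof.
rewrite lt0e measure_ge0 andbT; apply/eqP => S0.
suff V0 : mH V = 0%E by move: V_gt0; rewrite V0 ltxx.
rewrite -[V]setIT -(preimage_setT (path_map psi)).
rewrite (dis mV (@measurableT _ (pathm B))).
rewrite (ge0_ae_eq_integral (g := cst 0%E))//; first exact: integral0.
  exact: (measurable_kernel k V mV).
have nS : mB.-negligible S by exact/negligibleP.
apply: negligibleS (negligibleU nS fibre) => x /= /not_implyP[_ kx].
have [Sx|nSx] := pselect (S x); [by left|right].
move=> [y [_ _ /(_ V mV)]]; rewrite invr1 mul1e big_ord1 diracE.
by case: (_ \in _) => [/nSx|/kx].
Qed.

Let VS : mH (V `&` path_map psi @^-1` S) = mB S.
Proof.
rewrite dis// (eq_integral (cst 1%E)); last by move=> x; rewrite inE.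
by rewrite integral_cst// mul1e.
Qed.

(* The walk over i :: w from u lies over the cylinder and misses V; it has
   conditional probability st u. *)
Lemma cylinder_sync_bound (u : vertex H) (w : seq I) (i : I) :
  run lift u (i :: w) <> v ->
  (mH (V `&` path_map psi @^-1` cylinder (G := B) (i :: w))
     <= (1 - st u)%:E * mB (cylinder (G := B) (i :: w)))%E.
Proof.
move=> uv; have mC := @measurable_cylinder R B (i :: w).
have fC : mB (cylinder (G := B) (i :: w)) \is a fin_num by exact: fin_num_measure.
rewrite EFinB muleBl// mul1e -cylE -pushH// leeBrDr; last first.
  by apply: fin_num_measure; exact: measurable_cylinder.
rewrite -measureU; first 1 last.
- by apply: measurableI => //; exact: mpre.
- exact: measurable_cylinder.
- apply/seteqP; split=> // x [[Vx _]]; rewrite /cylinder /= mkseqS => -[x0 _].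
  by apply: uv; rewrite -Vx x0.
apply: le_measure; rewrite ?inE.
- apply: measurableU; last exact: measurable_cylinder.
  by apply: measurableI => //; exact: mpre.
- exact: mpre.
- move=> x [[]//|]; rewrite /cylinder /preimage /=; rewrite (size_liftw fl) => e.
  transitivity (map psi (mkseq (sval x) (size w).+1)).
    by rewrite /mkseq -map_comp.
  by rewrite e; exact: (map_liftw fl u (i :: w)).
Qed.

Lemma prefix_sync_bound (eps : R) n (D : set (seq I)) : 0 < eps < 1 ->
  (forall i w, (mH (V `&` path_map psi @^-1` cylinder (G := B) (i :: w))
     <= (1 - eps)%:E * mB (cylinder (G := B) (i :: w)))%E) ->
  (mH (V `&` path_map psi @^-1` prefix_set (G := B) n.+1 D)
     <= (1 - eps)%:E * mB (prefix_set (G := B) n.+1 D))%E.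
Proof.
move=> /andP[e0 e1] bnd; rewrite prefix_setE preimage_bigcup setI_bigcupr.
have tC := @cylinder_trivIset R B n.+1 [set w | D w /\ size w = n.+1]
  (fun w => @proj2 _ _).
rewrite !measure_bigcup_esum//; first 1 last.
- by move=> w; exact: measurable_cylinder.
- by move=> w; apply: measurableI => //; apply: mpre; exact: measurable_cylinder.
- move=> w w' Dw Dw' [x [[_ xw] [_ xw']]].
  by apply: (tC w w' Dw Dw'); exists (path_map psi x).
rewrite -esum_pZl ?subr_gt0//.
(* The empty word is ruled out by its length. *)
by apply: le_esum => -[|i w] [_ wn] //; exact: bnd.
Qed.

(** Otherwise every word leads [u1] or [u2] away from [v], so over each cylinder at least a
    proportion [eps] of the mass lies outside [V]. Over [S], however, almost all mass lies in [V],
    and [S] is nearly a union of cylinders. *)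
Lemma degree1_common_run u1 u2 : exists w, run lift u1 w = v /\ run lift u2 w = v.
Proof.
apply: contrapT => nex.
have Hst := sgraph_stochastic H.
(* The bound [2^-1] keeps [eps] below 1 even when both stationary probabilities are 1. *)
pose eps := Num.min 2^-1 (Num.min (st u1) (st u2)).
have e0 : 0 < eps by rewrite !lt_min invr_gt0 ltr0n !(st_gt0 Hst).
have e1 : eps < 1 by rewrite !gt_min invf_lt1 ?ltr1n// ltr0n.
have bnd i w : (mH (V `&` path_map psi @^-1` cylinder (G := B) (i :: w))
     <= (1 - eps)%:E * mB (cylinder (G := B) (i :: w)))%E.
  have bu u : eps <= st u -> run lift u (i :: w) <> v ->
      (mH (V `&` path_map psi @^-1` cylinder (G := B) (i :: w))
       <= (1 - eps)%:E * mB (cylinder (G := B) (i :: w)))%E.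
    move=> eu /cylinder_sync_bound/le_trans; apply.
    by rewrite lee_wpmul2r// lee_fin lerB.
  have [r1|] := pselect (run lift u1 (i :: w) = v); last first.
    by apply: bu; rewrite !ge_min lexx !orbT.
  apply: (bu u2); first by rewrite !ge_min lexx !orbT.
  by move=> r2; apply: nex; exists (i :: w).
have fS : mB S \is a fin_num by exact: fin_num_measure.
have Sfin : mB S = (fine (mB S))%:E by rewrite fineK.
set b := fine (mB S) in Sfin.
have b0 : 0 < b by move: S_gt0; rewrite Sfin lte_fin.
(* The final estimate reads [b <= b - eps * b + (2 - eps) * eta]; this [eta] makes it absurd, the
   last term being less than [eps * b / 2]. *)
pose eta := eps * b / 4.
have eta0 : 0 < eta by rewrite divr_gt0// mulr_gt0.
have [_ /(_ _ eta0)[n [D leS]]] := measurable_approximable mB mS.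
have mD := measurable_prefix_set (G := B) n.+1 D.
set A := prefix_set (G := B) n.+1 D in leS mD *.
have mY : measurable (S `+` A) by exact: measurableY.
have VA : (mH (V `&` path_map psi @^-1` A) <= (1 - eps)%:E * mB A)%E.
  by apply: prefix_sync_bound bnd; rewrite e0.
have leA : (mB A <= (b + eta)%:E)%E.
  apply: (@le_trans _ _ (mB (S `|` (S `+` A)))).
    apply: le_measure; rewrite ?inE//; first exact: measurableU.
    move=> x Ax; have [Sx|nSx] := pselect (S x); first by left.
    by right; rewrite setY_def; right.
  apply: (le_trans (measureU2 _ mS mY)).
  by rewrite EFinD; apply: leeD leS; rewrite -Sfin.
have : (b%:E <= ((1 - eps) * (b + eta) + eta)%:E)%E.
  rewrite -Sfin -VS.
  apply: (@le_trans _ _ (mH ((V `&` path_map psi @^-1` A) `|`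
                             path_map psi @^-1` (S `+` A)))).
    apply: le_measure; rewrite ?inE.
    - by apply: measurableI => //; exact: mpre.
    - apply: measurableU; last exact: mpre.
      by apply: measurableI => //; exact: mpre.
    - move=> x [Vx Sx]; have [Ax|nAx] := pselect (A (path_map psi x)).
        by left.
      have : (S `+` A) (path_map psi x) by rewrite setY_def; left.
      by right.
  apply: (le_trans (measureU2 _ _ _)); [|exact: mpre|].
    by apply: measurableI => //; exact: mpre.
  rewrite EFinD; apply: leeD; last by apply: le_trans leS; rewrite -(pushH mY).
  apply: (le_trans VA); rewrite EFinM lee_wpmul2l// lee_fin subr_ge0.
  exact: ltW.
rewrite lee_fin; have -> : eta = eps * b / 4 by [].
have eb : 0 < eps * b by rewrite mulr_gt0.
have : 0 < eps * (eps * b) by rewrite mulr_gt0.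
by lra.
Qed.

End Synchronization.

Section DegreeOneSync.
Variables (R : realType) (I : countType) (rho : I -> R).
Variables (rho_gt0 : forall i, 0 < rho i)
  (rho_sum1 : (\esum_(i in [set: I]) (rho i)%:E = 1)%E).
Variables (H : sgraph R) (psi : hom H (bernoulli rho_gt0 rho_sum1)).
Variable lift : vertex H -> I -> edge H.
Hypothesis fl : deterministic (psi : edge H -> I) lift.

Lemma degree1_sync : has_degree psi 1 -> forall u v, exists w, sync lift u v w.
Proof.
move=> [mH [mB [k [mHP mBP dis fibre]]]] u v.
have [w [uw vw]] := degree1_common_run fl mHP mBP dis fibre u u v.
by exists w; rewrite /sync uw vw.
Qed.

End DegreeOneSync.

(** * The maximal quotient *)

Section HomLemmas.
Variable R : realType.
Implicit Types G H K : wgraph R.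

Lemma irreducible_hom G H (f : edge G -> edge H) (f0 : vertex G -> vertex H) :
  hom_along f f0 -> irreducible_graph G -> irreducible_graph H.
Proof.
move=> [sf tf surj _ _] Girr u v.
have [u' <-] := surj u; have [v' <-] := surj v.
have [g [l [gl gu gv]]] := Girr u' v'.
exists (f g), (map f l); split; last by rewrite tf gv.
  rewrite path.path_map; apply: sub_path gl => h h' /eqP hh'.
  by rewrite /composable /= sf tf hh'.
by rewrite last_map sf gu.
Qed.

Lemma hom_along_comp G H K (f : edge G -> edge H) f0 (g : edge H -> edge K) g0 :
  hom_along f f0 -> hom_along g g0 -> hom_along (g \o f) (g0 \o f0).
Proof.
move=> [sf tf surf bijf wf] [sg tg surg bijg wg]; split=> /=.
- by move=> h; rewrite sg sf.
- by move=> h; rewrite tg tf.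
- by move=> v; have [u <-] := surg v; have [u' <-] := surf u; exists u'.
- by move=> u; exact: set_bij_comp (bijf u) (bijg (f0 u)).
- by move=> h; rewrite wg wf.
Qed.

(** A homomorphism is already bijective on the edges out of each vertex and surjective on vertices,
    so only injectivity on vertices can fail. *)
Lemma injective_is_iso G H (f : hom G H) (f0 : vertex G -> vertex H) :
  hom_along f f0 -> injective f0 -> is_iso f.
Proof.
move=> ff0 inj0; have [sf tf surf bijf wf] := ff0.
have bij0 : bijective f0.
  rewrite -setTT_bijective; split=> //; first by move=> x y _ _; exact: inj0.
  by move=> v _; have [u <-] := surf v; exists u.
split; last by exists f0.
rewrite -setTT_bijective; split=> //.
  move=> g g' _ _ gg'; have sgg' : src g = src g'.
    by apply: inj0; rewrite -!sf gg'.
  by have [_ inj _] := bijf (src g); apply: inj => //; rewrite inE.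
move=> h _; have [u hu] := surf (src h).
by have [_ _ /(_ h) []] := bijf u; [rewrite /= hu|move=> g _ <-; exists g].
Qed.

(** The transfer equation says exactly that the change of fibre coordinate by [w^-1] is compatible
    with targets. *)
Lemma skew_hom G H d (f : edge G -> edge H) (f0 : vertex G -> vertex H)
    (a : edge G -> 'S_d) (b : edge H -> 'S_d) (w : vertex G -> 'S_d) :
  hom_along f f0 ->
  (forall g, (w (src g) * a g = b (f g) * w (tgt g))%g) ->
  hom_along (G := Defs.skew a) (H := Defs.skew b)
    (fun x => (f x.1, (w (src x.1))^-1%g x.2))
    (fun u => (f0 u.1, (w u.1)^-1%g u.2)).
Proof.
move=> [sf tf surj bijf wf] wab; split=> /=.
- by move=> [g y] /=; rewrite sf.
- move=> [g y] /=; rewrite tf; congr (_, _).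
  rewrite -!permM; congr (fun_of_perm _ y).
  by apply: (mulgI (w (src g))); rewrite mulKVg mulgA wab mulgK.
- by move=> [v y]; have [u <-] := surj v; exists (u, w u y); rewrite /= permK.
- move=> [u y]; have [_ inj sur] := bijf u; split.
  + by move=> [g z] /= [<- <-]; rewrite sf.
  + move=> [g z] [g' z'] /[!inE] /= -[gu ->] [g'u ->] [gg' _]; congr (_, _).
    by apply: inj; rewrite ?inE.
  + move=> [h z] /= [hu ->]; have [g gu <-] := sur _ hu.
    by exists (g, y); rewrite /= gu.
- by move=> [g y] /=; rewrite wf.
Qed.

Lemma cohomologousP G d (a b : edge G -> 'S_d) :
  cohomologous b a <->
  exists w : vertex G -> 'S_d, forall g, (w (src g) * a g = b g * w (tgt g))%g.
Proof.
split=> -[w wP]; exists w => g; first by apply/permP => y; rewrite !permM wP.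
by move=> y; move/permP: (wP g) => /(_ y); rewrite !permM.
Qed.

End HomLemmas.

Section Factors.
Variables (R : realType) (I : countType) (rho : I -> R).
Variables (rho_gt0 : forall i, 0 < rho i)
  (rho_sum1 : (\esum_(i in [set: I]) (rho i)%:E = 1)%E).
Local Notation B := (bernoulli rho_gt0 rho_sum1).
Variable d : nat.
Implicit Types e : extension B d.

(* w u is the transfer from the fibre over k0 u to the fibre over u; the
   homomorphism kbar of ext_morphism can be recovered from k and w. *)
Definition factor e1 e (k : edge (ext_base e) -> edge (ext_base e1))
    (k0 : vertex (ext_base e) -> vertex (ext_base e1))
    (w : vertex (ext_base e) -> 'S_d) : Prop :=
  [/\ hom_along k k0, forall h, ext_psi e1 (k h) = ext_psi e h
    & forall h, (w (src h) * ext_fun h = ext_fun (k h) * w (tgt h))%g].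

Lemma le_factor e1 e : ext_le e1 e -> exists k k0 w, @factor e1 e k k0 w.
Proof.
move=> [_ [k [_ kpsi /cohomologousP[w wP]]]].
by have [k0 kk0] := hom_ax k; exists k, k0, w.
Qed.

Lemma factor_morphism e1 e k k0 w : @factor e1 e k k0 w ->
  exists (kbar : hom (ext_top e) (ext_top e1)) (k' : hom (ext_base e) (ext_base e1)),
    [/\ ext_morphism kbar k',
        hom_along k' k0
      & hom_along kbar (fun u : vertex (ext_top e) => (k0 u.1, (w u.1)^-1%g u.2))].
Proof.
move=> [kk0 kpsi wP]; have kbar := skew_hom kk0 wP.
exists (@Defs.Hom _ (ext_top e) (ext_top e1) _ (ex_intro _ _ kbar)).
exists (@Defs.Hom _ (ext_base e) (ext_base e1) k (ex_intro _ _ kk0)).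
by split=> //; split=> //; apply/cohomologousP; exists w.
Qed.

Lemma factor_le e1 e k k0 w : @factor e1 e k k0 w -> ext_le e1 e.
Proof. by move=> /factor_morphism[kbar [k' [? _ _]]]; exists kbar, k'. Qed.

Lemma factor_equiv e1 e k k0 w : @factor e1 e k k0 w -> injective k0 ->
  ext_equiv e1 e.
Proof.
move=> /factor_morphism[kbar [k' [? hk hkbar]]] inj0; exists kbar, k'; split=> //.
  apply: injective_is_iso hkbar _ => -[u y] [u' y'] /= [/inj0 <-].
  by move/perm_inj => <-.
exact: injective_is_iso hk inj0.
Qed.

Lemma factor_comp e2 e1 e k k0 w k' k0' w' :
  @factor e1 e k k0 w -> @factor e2 e1 k' k0' w' ->
  @factor e2 e (k' \o k) (k0' \o k0) (fun u => w' (k0 u) * w u)%g.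
Proof.
move=> [kk0 kpsi wP] [kk0' kpsi' wP']; split.
- exact: hom_along_comp kk0 kk0'.
- by move=> h /=; rewrite kpsi' kpsi.
- move=> h /=; have [sk tk _ _ _] := kk0.
  by rewrite -mulgA wP !mulgA -sk wP' tk.
Qed.

(** The inverse maps form a factor, with the inverse transfer function. *)
Lemma ext_equiv_sym e1 e : ext_equiv e1 e -> ext_equiv e e1.
Proof.
move=> [_ [k [[_ kpsi /cohomologousP[w wP]] _ [kbij [k0 [kk0 k0bij]]]]]].
have [k' kK k'K] := kbij; have [k0' k0K k0'K] := k0bij.
have [sk tk _ bijk wk] := kk0.
have sk' h : src (k' h) = k0' (src h) by rewrite -{2}(k'K h) sk k0K.
have tk' h : tgt (k' h) = k0' (tgt h) by rewrite -{2}(k'K h) tk k0K.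
apply: (@factor_equiv e e1 k' k0' (fun u => (w (k0' u))^-1)%g); last exact: can_inj k0'K.
split.
- split=> //.
  + by move=> u; exists (k0 u).
  + move=> v; split.
    * by move=> h /= <-.
    * by move=> h h' _ _ /(can_inj k'K).
    * move=> g /= gv; exists (k g); last exact: kK.
      by rewrite sk gv k0'K.
  + by move=> h; rewrite -wk k'K.
- by move=> h; rewrite -kpsi k'K.
- move=> h; rewrite -sk' -tk'; apply: (mulgI (w (src (k' h)))).
  by rewrite mulKVg mulgA wP k'K mulgK.
Qed.

End Factors.

(** * The quotient by fibre equivalence and its universal property *)

Section MaximalQuotient.
Variables (R : realType) (I : countType) (rho : I -> R).
Variables (rho_gt0 : forall i, 0 < rho i)
  (rho_sum1 : (\esum_(i in [set: I]) (rho i)%:E = 1)%E).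
Local Notation B := (bernoulli rho_gt0 rho_sum1).
Variable d : nat.
Implicit Types e : extension B d.

Section Holonomy.
Variables (e e1 : extension B d).
Variables (lift : vertex (ext_base e) -> I -> edge (ext_base e)).
Hypothesis fl : deterministic (ext_psi e : edge (ext_base e) -> I) lift.
Variables (k : edge (ext_base e) -> edge (ext_base e1))
  (k0 : vertex (ext_base e) -> vertex (ext_base e1))
  (w : vertex (ext_base e) -> 'S_d).
Hypothesis kP : factor k k0 w.

Lemma factor_transport lift1 (fl1 : deterministic (ext_psi e1 : _ -> I) lift1) u s :
  (w u * transport lift (@ext_fun _ _ _ e) u s =
   transport lift1 (@ext_fun _ _ _ e1) (k0 u) s * w (run lift u s))%g.
Proof.
have [kk0 kpsi wP] := kP; elim: s => [|i s IH] /=; first by rewrite mul1g mulg1.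
rewrite mulgA IH -!mulgA; congr (_ * _)%g.
rewrite -(hom_run fl fl1 kk0 kpsi) -(hom_lift fl fl1 kk0 kpsi) -wP.
by rewrite (src_lift fl).
Qed.

(** From two vertices with one image, [s] has the same transport in the factor, so by
    [factor_transport] only the transfers survive, and these do not involve [s]. *)
Lemma factor_hol u v s : k0 u = k0 v -> sync lift u v s ->
  hol lift (@ext_fun _ _ _ e) u v s = ((w u)^-1 * w v)%g.
Proof.
move=> kuv suv; have [lift1 fl1] := bernoulli_lift (ext_psi e1).
have hu := factor_transport fl1 u s; have hv := factor_transport fl1 v s.
apply: (mulgI (w u)); apply: (mulIg (transport lift (@ext_fun _ _ _ e) v s)).
by rewrite /hol !mulgA mulgKV mulgV mul1g hu hv kuv suv.
Qed.

Lemma factor_fiber_equiv u v : k0 u = k0 v ->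
  fiber_equiv lift (@ext_fun _ _ _ e) u v.
Proof. by move=> kuv s1 s2 h1 h2; rewrite !factor_hol. Qed.

End Holonomy.

Variable e : extension B d.
Local Notation H := (ext_base e).
Local Notation a := (@ext_fun _ _ _ e).
Variable lift : vertex H -> I -> edge H.
Hypothesis fl : deterministic (ext_psi e : edge H -> I) lift.

Let exsync : forall u v, exists w, sync lift u v w.
Proof. exact: degree1_sync fl (ext_degree1 e). Qed.

Local Notation r := (rep lift a).

Let r_idem u : r (r u) = r u.
Proof. exact: rep_idem. Qed.

Let r_step u i : r (tgt (lift (r u) i)) = r (tgt (lift u i)).
Proof.
apply/(eq_rep _ exsync)/fiber_equiv_step/fiber_equiv_sym; exact: repP.
Qed.

Let wt_lift u v i : wt (lift u i) = wt (lift v i).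
Proof. by rewrite !(wt_bernoulli (ext_psi e)) !(lab_lift fl). Qed.

(** The canonical holonomy from the fibre over the representative to the fibre over [u], the
    direction required by [factor]. *)
Let w u : 'S_d := chol a exsync (r u) u.

Let Q : sgraph R := qgraph fl r_idem r_step wt_lift.
Let q : hom H Q := qproj_morphism fl r_idem r_step wt_lift.
Let q0 : vertex H -> vertex Q := qproj0 r_idem.

Let qq0 : hom_along q q0.
Proof. exact: qproj_hom. Qed.

(** The source of [val g] is a representative, where [w] is trivial; the effective correction is at
    the target, which is moved back to its representative. *)
Definition max_fun (g : edge Q) : 'S_d :=
  (w (src (val g)) * a (val g) * (w (tgt (val g)))^-1)%g.

Lemma max_fun_cocycle g : (w (src g) * a g = max_fun (q g) * w (tgt g))%g.
Proof.
have ru u : fiber_equiv lift a (r u) u by apply: fiber_equiv_sym; exact: repP.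
rewrite /max_fun /= !(src_lift fl) !r_idem.
set u := src g; set i := ext_psi e g; set v := r u.
rewrite -(liftK fl g) -/u -/i.
have -> : w v = 1%g by rewrite /w r_idem chol_refl.
(* The two targets share a representative, so the transfer to the second is the transfer to the
   first followed by the holonomy between them. *)
have rtt := r_step u i; rewrite -/v in rtt.
rewrite mul1g /w (@chol_step _ _ _ _ _ _ exsync v u i (ru u)) mulgKV.
have tt : fiber_equiv lift a (tgt (lift v i)) (tgt (lift u i)).
  exact: fiber_equiv_step (ru u).
rewrite -mulgA; congr (_ * _)%g.
rewrite -rtt -(chol_trans exsync (ru _) tt).
by rewrite mulKg.
Qed.

Let psiQ_ax : exists f0 : vertex Q -> vertex B,
  hom_along (G := Q) (H := B) (@qlab _ _ _ (ext_psi e : edge H -> I) r) f0.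
Proof.
exists (fun=> tt).
have dB : deterministic (G := B) (fun i : I => i) (fun _ i => i).
  by split=> // -[].
apply: (@lift_hom _ Q B _ _ _ _ _ (qdet fl r_idem) dB (fun=> tt)) => //.
  by case; have [u _] := sgraph_vertex_ex H; exists (q0 u).
by move=> u i; rewrite /= (wt_bernoulli (ext_psi e)) (lab_lift fl).
Qed.

Definition max_psi : hom Q B := @Defs.Hom _ Q B _ psiQ_ax.

Let max_psi_q g : max_psi (q g) = ext_psi e g.
Proof. exact: qlab_proj. Qed.

Let max_degree1 : has_degree max_psi 1.
Proof.
apply: (has_degree1_factor max_psi_q) (ext_degree1 e) => m mP.
exact: quotient_path_law.
Qed.

Let max_irred : irreducible_graph (Defs.skew max_fun).
Proof.
have h := skew_hom qq0 max_fun_cocycle.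
exact: (irreducible_hom h (ext_irred (e := e))).
Qed.

Definition max_ext : extension B d :=
  @Extension R B d Q max_fun max_psi max_degree1 max_irred.

Lemma max_factor : @factor _ _ _ _ _ d max_ext e q q0 w.
Proof. by split; [exact: qq0|exact: max_psi_q|exact: max_fun_cocycle]. Qed.

(** Composing with the projection from [e] shows that vertices with equal images are representatives
    fibre-equivalent in [H], hence equal. *)
Lemma max_irreducible : ext_irreducible max_ext.
Proof.
move=> e1 /le_factor[k [k0 [w1 kP]]]; apply: (factor_equiv kP) => x y kxy.
have := factor_comp max_factor kP => /(factor_fiber_equiv fl) eqv.
rewrite -(qproj0_val r_idem x) -(qproj0_val r_idem y).
apply: val_inj; apply/(eq_rep _ exsync)/eqv => /=.
have qv (z : vertex Q) : q0 (val z) = z by exact: qproj0_val.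
by rewrite !qv.
Qed.

(** Vertices identified by [k0] are fibre-equivalent, so [q0] descends along [k0], and so does the
    quotient of the two transfer functions. *)
Lemma max_le_factor e' : ext_le e' e -> ext_le max_ext e'.
Proof.
move=> /le_factor[k [k0 [wk kP]]]; have [kk0 kpsi wkP] := kP.
(* Only the factor equations of the transfer matter below, so its definition is hidden. *)
have [wq wqF] : exists wq, @factor _ _ _ _ _ d max_ext e q q0 wq.
  by exists w; exact: max_factor.
have [_ _ wqP] := wqF.
have [lift' fl'] := bernoulli_lift (ext_psi e').
have [_ _ k0surj kbij wk'] := kk0.
have [s sP] := choice k0surj.
have q0s u : q0 (s (k0 u)) = q0 u.
  apply: val_inj; apply/(eq_rep _ exsync)/(factor_fiber_equiv fl kP).
  by rewrite sP.
pose k0' v : vertex Q := q0 (s v).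
have k0'k u : k0' (k0 u) = q0 u by exact: q0s.
have step v i : k0' (tgt (lift' v i)) =
    tgt (w := Q) (qlift fl r_idem (k0' v) i).
  rewrite -(sP v) -(hom_lift fl fl' kk0 kpsi).
  have [_ tk _ _ _] := kk0; rewrite tk !k0'k.
  have [_ tq _ _ _] := qq0; apply: etrans (esym (tq _)) _.
  apply: (congr1 (@tgt _ Q)).
  exact: (hom_lift fl (qdet fl r_idem) qq0 max_psi_q).
have k'hom : hom_along (H := Q)
    (fun h => qlift fl r_idem (k0' (src h)) (ext_psi e' h)) k0'.
  apply: (lift_hom fl' (qdet fl r_idem)) => //.
  - by move=> x; exists (k0 (val x)); rewrite k0'k; exact: qproj0_val.
  - move=> v i /=; rewrite (wt_bernoulli (ext_psi e')) (lab_lift fl').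
    by rewrite (wt_bernoulli (ext_psi e)) (lab_lift fl).
(* Both factors compute the holonomy between [u] and [v] from their transfers, so [wq * wk^-1] is
   constant on the fibres of [k0]. *)
have wkq u v : k0 u = k0 v -> (wq u * (wk u)^-1 = wq v * (wk v)^-1)%g.
  move=> kuv; have [W uvW] := exsync u v.
  have quv : q0 u = q0 v by rewrite -(q0s u) -(q0s v) kuv.
  have := factor_hol fl kP kuv uvW.
  rewrite (factor_hol fl wqF quv uvW) => E.
  apply: (mulgI (wq u)^-1%g); apply: (mulIg (wk v)).
  by rewrite mulKg !mulgA mulgKV -E.
apply: (@factor_le _ _ _ _ _ d max_ext e' _ k0'
  (fun v => wq (s v) * (wk (s v))^-1)%g); split.
- exact: k'hom.
- by move=> h; rewrite /= /qlab /= (lab_lift fl).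
(* Every edge is the image of some [h], at whose endpoints the transfers may be evaluated in place
   of the preimages chosen by [s]. *)
- move=> h'; have [h hk] : exists h, k h = h'.
    have [_ _ /(_ h')] := kbij (s (src h')).
    by case=> [|h _ <-]; [rewrite /= sP|exists h].
  have sk : k0 (s (src h')) = k0 (src h).
    by rewrite sP -hk; have [-> _ _ _ _] := kk0.
  have tk : k0 (s (tgt h')) = k0 (tgt h).
    by rewrite sP -hk; have [_ -> _ _ _] := kk0.
  rewrite (wkq _ _ sk) (wkq _ _ tk).
  have -> : qlift fl r_idem (k0' (src h')) (ext_psi e' h') = q h.
    rewrite -hk kpsi; have [-> _ _ _ _] := kk0; rewrite k0'k.
    by [].
  apply: (mulIg (wk (tgt h))).
  transitivity (wq (src h) * a h)%g.
    by rewrite -!mulgA -hk -wkP mulKg.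
  by rewrite wqP; move: (ext_fun _) => z; rewrite -mulgA mulgKV.
Qed.

End MaximalQuotient.

Theorem theorem4p12 (R : realType) (I : countType) (rho : I -> R)
    (rho_gt0 : forall i : I, 0 < rho i)
    (rho_sum1 : (\esum_(i in [set: I]) (rho i)%:E = 1)%E)
    (d : nat) (d_gt0 : (0 < d)%N)
    (e : extension (bernoulli rho_gt0 rho_sum1) d) :
  exists es : extension (bernoulli rho_gt0 rho_sum1) d,
    [/\ ext_irreducible es,
        ext_le es e
      & forall e' : extension (bernoulli rho_gt0 rho_sum1) d,
          ext_irreducible e' -> ext_le e' e -> ext_equiv e' es].
Proof.
have [lift fl] := bernoulli_lift (ext_psi e).
exists (max_ext fl); split.
- exact: max_irreducible.
- exact: factor_le (max_factor fl).
(* The maximal quotient lies below [e'], so irreducibility of [e'] makes the two equivalent. *)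
- by move=> e' e'irr /(max_le_factor fl)/e'irr/ext_equiv_sym.
Qed.
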